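(* Let $X$ be an infinite approximate subring of a field such that for every positive $n\in\mathbb{N}$ the set $\mathrm{Alg}_n(X)$ is covered by finitely many additive translates of $X$. Then $4X+X\cdot 4X$ is a subfield.
   Context: For subsets $Y,Z$ of a field, $Y+Z=\{y+z\}$, $Y\cdot Z=\{yz\}$ ($y\in Y,z\in Z$), and $nZ$ is the set of sums of $n$ elements of $Z$. A subset $X$ of a ring is an approximate subring if it is additively symmetric ($0\in X$, $X=-X$) and $(X\cdot X)\cup(X+X)$ is covered by finitely many additive translates of $X$. $\mathrm{Alg}_n(X)$ denotes the set of quotients $a/b$ (with $b\neq 0$) where each of $a,b$ is a sum of at most $n$ terms, each of which is a product of at most $n$ elements of $X$. *)

(* Defs.v *)
From mathcomp Require Import all_boot all_order all_algebra.
From mathcomp Require Import boolp classical_sets cardinality.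

Set Implicit Arguments.
Unset Strict Implicit.
Unset Printing Implicit Defensive.

Import GRing.Theory.

Local Open Scope classical_set_scope.
Local Open Scope ring_scope.

Definition sumset (R : pzRingType) (Y Z : set R) : set R :=
  [set y + z | y in Y & z in Z].

Definition prodset (R : pzRingType) (Y Z : set R) : set R :=
  [set y * z | y in Y & z in Z].

(* The sums of exactly n elements of Z, repetitions allowed; not the dilate
   {n * z | z in Z}. *)
Definition nsumset (R : pzRingType) (n : nat) (Z : set R) : set R :=
  [set \sum_(i < n) f i | f in [set f : 'I_n -> R | forall i, Z (f i)]].

Definition finitely_covered (R : pzRingType) (Y X : set R) : Prop :=
  exists2 F : set R, finite_set F & Y `<=` \bigcup_(c in F) [set c + x | x in X].

Definition additively_symmetric (R : pzRingType) (X : set R) : Prop :=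
  X 0 /\ X = [set - x | x in X].

Definition approximate_subring (R : pzRingType) (X : set R) : Prop :=
  additively_symmetric X /\
  finitely_covered (prodset X X `|` sumset X X) X.

(* Products are nonempty, so that 1 is not put in Alg n X by convention. If X
   contains some x != 0, also allowing the empty product would only give a
   subset of Alg n.+1 X (multiply numerator and denominator by x). The empty
   sum is harmless when 0 belongs to X. *)
Definition short_product (R : pzRingType) (n : nat) (X : set R) : set R :=
  [set p | exists2 k, (0 < k <= n)%N &
     exists2 f : 'I_k -> R, (forall i, X (f i)) & p = \prod_(i < k) f i].

Definition short_sum (R : pzRingType) (n : nat) (X : set R) : set R :=
  [set a | exists2 k, (k <= n)%N & nsumset k (short_product n X) a].

Definition Alg (K : fieldType) (n : nat) (X : set K) : set K :=
  [set q | exists a b, [/\ short_sum n X a, short_sum n X b, b != 0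
                        & q = a / b]].

(* divring_closed: contains 1, closed under subtraction and division (by 0
   too, but x / 0 = 0 in a fieldType). *)
Definition is_subfield (K : fieldType) (A : set K) : Prop :=
  divring_closed [in A].

(* Main.v *)
(** The quotients [Alg n X], over all [n], form a field [F], and each dilate
    [y X] with [y] in [F] is covered by finitely many translates of [X].
    Since [X] is infinite, pigeonhole gives distinct [v, w] in [X] with
    [y (v - w)] in [X - X = 2X], so that [F = Alg 2 X]; hence [F = C + X] for
    some finite subset [C] of [F]. Pigeonhole for the multipliers in [C] and 1
    simultaneously gives a nonzero [d = v - w] such that [d] and all [c d],
    [c] in [C], are in [2X]. For [y] in [F], write [y / d = c + x]; then
    [y = c d + x d] is in [2X + X . 2X]. *)

Require Import Defs.
From mathcomp Require Import all_boot all_order all_algebra.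
From mathcomp Require Import boolp classical_sets cardinality.

Set Implicit Arguments.
Unset Strict Implicit.
Unset Printing Implicit Defensive.

Import GRing.Theory.

Local Open Scope classical_set_scope.
Local Open Scope ring_scope.

(** * Sums and products indexed by sequences; arithmetic of short sums *)

Lemma nsumset_seqP (R : pzRingType) n (Z : set R) a :
  nsumset n Z a <->
  exists s : seq R,
    [/\ size s = n, (forall x, x \in s -> Z x) & a = \sum_(x <- s) x].
Proof.
split=> [[f Zf <-]|[s [<- Zs ->]]].
  exists [seq f i | i <- enum 'I_n]; split.
  - by rewrite size_map size_enum_ord.
  - by move=> x /mapP[i _ ->]; exact: Zf.
  - by rewrite big_map big_enum.
exists (fun i : 'I_(size s) => s`_i); last by rewrite (big_nth 0) big_mkord.
by move=> i; apply: Zs; rewrite mem_nth.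
Qed.

Lemma short_sum_seqP (R : pzRingType) n (X : set R) a :
  short_sum n X a <->
  exists s : seq R, [/\ (size s <= n)%N,
    (forall x, x \in s -> short_product n X x) & a = \sum_(x <- s) x].
Proof.
split=> [[k kn /nsumset_seqP[s [sk Ps ->]]]|[s [sn Ps ->]]].
  by exists s; rewrite sk.
by exists (size s) => //; apply/nsumset_seqP; exists s.
Qed.

Lemma short_product_seqP (R : pzRingType) n (X : set R) a :
  short_product n X a <->
  exists s : seq R, [/\ (0 < size s <= n)%N,
    (forall x, x \in s -> X x) & a = \prod_(x <- s) x].
Proof.
split=> [[k kn [f Xf ->]]|[s [sn Xs ->]]].
  exists [seq f i | i <- enum 'I_k]; split.
  - by rewrite size_map size_enum_ord.
  - by move=> x /mapP[i _ ->]; exact: Xf.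
  - by rewrite big_map enumT [index_enum _]unlock.
exists (size s) => //; exists (fun i => s`_i).
  by move=> i; apply: Xs; rewrite mem_nth.
by rewrite (big_nth 0) big_mkord.
Qed.

Section ShortSums.
Variables (R : pzRingType) (X : set R).

Lemma short_product_le n m a :
  (n <= m)%N -> short_product n X a -> short_product m X a.
Proof.
move=> nm [k /andP[k0 kn] Xk]; exists k => //.
by rewrite k0 (leq_trans kn).
Qed.

Lemma short_sum_le n m a : (n <= m)%N -> short_sum n X a -> short_sum m X a.
Proof.
move=> nm /short_sum_seqP[s [sn Ps ->]]; apply/short_sum_seqP; exists s.
split=> [|x /Ps|//]; first exact: leq_trans nm.
exact: short_product_le.
Qed.

Lemma short_productM n m a b : short_product n X a -> short_product m X b ->
  short_product (n + m) X (a * b).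
Proof.
move=> /short_product_seqP[s [/andP[s0 sn] Xs ->]].
move=> /short_product_seqP[t [/andP[t0 tm] Xt ->]].
apply/short_product_seqP; exists (s ++ t); split.
- by rewrite size_cat leq_add // addn_gt0 s0.
- by move=> x; rewrite mem_cat => /orP[/Xs|/Xt].
- by rewrite big_cat.
Qed.

Lemma short_sum0 n : short_sum n X 0.
Proof. by apply/short_sum_seqP; exists [::]; rewrite big_nil. Qed.

Lemma short_sum1 x : X x -> short_sum 1 X x.
Proof.
move=> Xx; apply/short_sum_seqP; exists [:: x]; rewrite big_seq1.
split=> // _ /[1!inE]/eqP->; apply/short_product_seqP; exists [:: x].
by rewrite big_seq1; split=> // _ /[1!inE]/eqP->.
Qed.

Lemma short_sumD n m a b : short_sum n X a -> short_sum m X b ->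
  short_sum (n + m) X (a + b).
Proof.
move=> /short_sum_seqP[s [sn Ps ->]] /short_sum_seqP[t [tm Pt ->]].
apply/short_sum_seqP; exists (s ++ t); split.
- by rewrite size_cat leq_add.
- move=> x; rewrite mem_cat => /orP[/Ps|/Pt]; apply: short_product_le.
    exact: leq_addr.
  exact: leq_addl.
- by rewrite big_cat.
Qed.

(** Expanding the product gives at most [n * m] terms with at most [n + m] factors each. One index
    bounds both counts, so the two bounds are added. *)
Lemma short_sumM n m a b : short_sum n X a -> short_sum m X b ->
  short_sum (n * m + (n + m)) X (a * b).
Proof.
move=> /short_sum_seqP[s [sn Ps ->]] /short_sum_seqP[t [tm Pt ->]].
apply/short_sum_seqP; exists [seq x * y | x <- s, y <- t]; split.
- by rewrite size_allpairs (leq_trans (leq_mul sn tm)) ?leq_addr.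
- move=> _ /allpairsP[[x y] /= [/Ps Px /Pt Py ->]].
  by apply: short_product_le (short_productM Px Py); exact: leq_addl.
- rewrite big_allpairs_dep mulr_suml; apply: eq_bigr => x _.
  by rewrite mulr_sumr.
Qed.

Lemma short_sumN n a : additively_symmetric X ->
  short_sum n X a -> short_sum n X (- a).
Proof.
move=> [_ XN] /short_sum_seqP[s [sn Ps ->]].
apply/short_sum_seqP; exists [seq - x | x <- s]; split.
- by rewrite size_map.
(* Short products are nonempty, so the first factor can absorb the sign; it stays in [X] by
   symmetry. *)
- move=> _ /mapP[x /Ps/short_product_seqP[[|y t] [// tn Xt ->]] ->].
  apply/short_product_seqP; exists (- y :: t); split=> //.
    move=> z /[1!inE]/orP[/eqP->|zt]; last by apply: Xt; rewrite inE zt orbT.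
    by rewrite XN; exists y => //; apply: Xt; rewrite mem_head.
  by rewrite !big_cons mulNr.
- by rewrite big_map sumrN.
Qed.

End ShortSums.

(** * The field of all quotients *)

Section Alg.
Variables (K : fieldType) (X : set K).
Hypothesis Xsym : additively_symmetric X.

Let X0 : X 0. Proof. by case: Xsym. Qed.

Let XN x : X x -> X (- x).
Proof. by case: Xsym => _ XE Xx; rewrite XE; exists x. Qed.

Lemma infinite_setD1 (A : set K) a : infinite_set A -> exists2 b, A b & b != a.
Proof.
move=> Ainf; apply: contrapT => Aa; apply: Ainf.
apply: (sub_finite_set _ (finite_set1 a)) => b Ab /=.
by apply: contrapT => /eqP ba; apply: Aa; exists b.
Qed.

Lemma AlgP n m a b :
  short_sum n X a -> short_sum m X b -> b != 0 -> Alg (maxn n m) X (a / b).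
Proof.
move=> Sa Sb b0; exists a, b; split=> //.
  exact: short_sum_le (leq_maxl _ _) Sa.
exact: short_sum_le (leq_maxr _ _) Sb.
Qed.

(** As soon as [X] has a nonzero element, this is the subfield generated by [X]. *)
Definition Alg_closure : set K := [set y | exists n, Alg n X y].

Lemma Alg_closureB y z :
  Alg_closure y -> Alg_closure z -> Alg_closure (y - z).
Proof.
move=> [n [a [b [Sa Sb b0 ->]]]] [m [c [d [Sc Sd d0 ->]]]].
rewrite -mulNr addf_div // mulNr; eexists; apply: AlgP.
- exact/(short_sumD (short_sumM Sa Sd))/(short_sumN Xsym)/(short_sumM Sc Sb).
- exact: short_sumM Sb Sd.
- by rewrite mulf_neq0.
Qed.

Lemma Alg_closure_div y z :
  Alg_closure y -> Alg_closure z -> Alg_closure (y / z).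
Proof.
move=> [n [a [b [Sa Sb b0 ->]]]] [m [c [d [Sc Sd d0 ->]]]].
(* If [c = 0], the divisor is zero and the quotient is [0] by convention; it is presented as
   [0 / b]. *)
have [->|c0] := eqVneq c 0.
  rewrite mul0r invr0 mulr0 -(mul0r b^-1).
  by eexists; apply: AlgP (short_sum0 _ 0) Sb b0.
rewrite invf_div mulf_div; eexists; apply: AlgP.
- exact: short_sumM Sa Sd.
- exact: short_sumM Sb Sc.
- by rewrite mulf_neq0.
Qed.

Section Infinite.
Hypothesis Xinf : infinite_set X.

Lemma Alg_closure1 : Alg_closure 1.
Proof.
have [x Xx x0] := infinite_setD1 0 Xinf.
by rewrite -(divff x0); eexists; apply: AlgP; rewrite ?x0 //; exact: short_sum1.
Qed.

Lemma sub_Alg_closure : X `<=` Alg_closure.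
Proof.
(* Since [1] need not lie in [X], [x] is written as [x * u / u]. *)
move=> x Xx; have [u Xu u0] := infinite_setD1 0 Xinf.
rewrite -(mulfK u0 x); eexists; apply: AlgP u0.
  exact: short_sumM (short_sum1 Xx) (short_sum1 Xu).
exact: short_sum1.
Qed.

Lemma subfield_Alg_closure : is_subfield Alg_closure.
Proof.
split=> [|y z|y z]; rewrite !inE.
- exact: Alg_closure1.
- exact: Alg_closureB.
- exact: Alg_closure_div.
Qed.

Lemma Alg_closureD y z :
  Alg_closure y -> Alg_closure z -> Alg_closure (y + z).
Proof.
move=> Fy Fz; rewrite -(opprK z) -(sub0r z).
exact/(Alg_closureB Fy)/(Alg_closureB _ Fz)/sub_Alg_closure.
Qed.

Lemma Alg_closureM y z :
  Alg_closure y -> Alg_closure z -> Alg_closure (y * z).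
Proof.
move=> Fy Fz; rewrite -(invrK z) -(div1r z).
exact/(Alg_closure_div Fy)/(Alg_closure_div Alg_closure1).
Qed.

Lemma nsumset_Alg_closure n : nsumset n X `<=` Alg_closure.
Proof.
move=> _ [f Xf <-]; elim/big_ind: _ => [||i _]; last exact/sub_Alg_closure/Xf.
  exact: sub_Alg_closure.
exact: Alg_closureD.
Qed.

End Infinite.

(** Pigeonhole, one multiplier at a time: an infinite set is thinned to an infinite [V] on which all
    [c * v] lie in a single translate [d + X]. The translation cancels in [c * (v - w)], which is
    thus in [X - X], and this is [X + X] by symmetry. Thinning preserves what earlier multipliers
    achieved. *)
Lemma infinite_common_difference (W : set K) (L : seq K) :
    (forall c, c \in L -> finitely_covered [set c * w | w in W] X) ->
    infinite_set W ->
  exists2 V : set K, V `<=` W /\ infinite_set V &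
    forall c v w, c \in L -> V v -> V w -> sumset X X (c * (v - w)).
Proof.
move=> covL Winf; elim: L covL => [|c L IH] covL; first by exists W => //; split.
have [a aL|V [VW Vinf] VL] := IH; first by apply: covL; rewrite inE aL orbT.
have [D Dfin WD] := covL c (mem_head _ _).
(* Otherwise [V] would be a finite union of finite sets, one for each centre in [D]. *)
have [d Dd dinf] : exists2 d, D d & infinite_set (V `&` [set v | X (c * v - d)]).
  apply: contrapT => noinf; apply: Vinf.
  apply: (@sub_finite_set _ _
    (\bigcup_(d in D) (V `&` [set v | X (c * v - d)]))).
    move=> v Vv; have [|d Dd [x Xx dx]] := WD (c * v).
      by exists v => //; exact: VW.
    by exists d => //; split=> //=; rewrite -dx addrC addKr.
  apply: bigcup_finite => // d Dd.
  by apply: contrapT => dinf; apply: noinf; exists d.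
exists (V `&` [set v | X (c * v - d)]).
  by split=> // v [/VW].
move=> a v w /[1!inE]/orP[/eqP->|aL] [Vv Xv] [Vw Xw]; last exact: VL.
exists (c * v - d) => //; exists (- (c * w - d)); first exact: XN.
by rewrite opprB addrA subrK mulrBr.
Qed.

(** * Consequences of the covering hypothesis *)

Section Covered.
Hypothesis Xinf : infinite_set X.
Hypothesis Xcov : forall n, (0 < n)%N -> finitely_covered (Alg n X) X.

(** In [(a / b) * x = (a * x) / b] the length bounds do not depend on [x], so one [Alg n X] contains
    the whole dilate. *)
Lemma dilate_finitely_covered y :
  Alg_closure y -> finitely_covered [set y * x | x in X] X.
Proof.
move=> [n [a [b [Sa Sb b0 ->]]]].
have [|D Dfin XD] := Xcov (n := maxn (n * 1 + (n + 1)) n).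
  by rewrite leq_max addn1 addnS.
exists D => // _ [x Xx <-]; apply: XD; rewrite mulrAC.
by apply: AlgP => //; exact: short_sumM Sa (short_sum1 Xx).
Qed.

Lemma common_difference (L : seq K) : (forall c, c \in L -> Alg_closure c) ->
  exists2 vw : K * K, [/\ X vw.1, X vw.2 & vw.1 - vw.2 != 0] &
    forall c, c \in L -> sumset X X (c * (vw.1 - vw.2)).
Proof.
move=> FL; have [|V [VX Vinf] VL] := @infinite_common_difference X L _ Xinf.
  by move=> c /FL; exact: dilate_finitely_covered.
(* Here [0] is arbitrary: any element of [V] will do for [v], and [w] is then chosen different from
   it. *)
have [v Vv _] := infinite_setD1 0 Vinf.
have [w Vw wv] := infinite_setD1 v Vinf.
exists (w, v) => /=; first by rewrite subr_eq0; split=> //; exact: VX.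
by move=> c cL; exact: VL.
Qed.

(** A common difference for the multiplier [y] gives [y = (x1 + x2) / (v - w)]. The index no longer
    depends on [y], so a single instance of the covering hypothesis handles the whole field. *)
Lemma Alg_closure_Alg2 : Alg_closure `<=` Alg 2 X.
Proof.
move=> y Fy; have [|[v w] [/= Xv Xw vw0]] := @common_difference [:: y].
  by move=> c /[1!inE]/eqP->.
move=> /(_ y (mem_head _ _))[x1 Xx1 [x2 Xx2 yvw]].
rewrite -(mulfK vw0 y) -yvw; apply: (@AlgP 2 2) => //.
  exact: (short_sumD (short_sum1 Xx1) (short_sum1 Xx2)).
exact: (short_sumD (short_sum1 Xv) (short_sum1 (XN Xw))).
Qed.

Lemma Alg_closure_finitely_covered : exists2 C : seq K,
  (forall c, c \in C -> Alg_closure c) &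
  forall y, Alg_closure y -> exists2 c, c \in C & X (y - c).
Proof.
have [D Dfin AD] := Xcov (n := 2) isT.
have /finite_seqP[C CE] : finite_set (D `&` Alg_closure).
  by apply: sub_finite_set Dfin => c [].
have inC c : (c \in C) = (D `&` Alg_closure) c :> Prop by rewrite CE.
exists C => [c|y Fy]; first by rewrite inC => -[].
have [c Dc [x Xx cx]] := AD y (Alg_closure_Alg2 Fy).
exists c; last by rewrite -cx addrC addKr.
rewrite inC; split=> //; rewrite -(addrK x c) cx.
exact/(Alg_closureB Fy)/sub_Alg_closure.
Qed.

Lemma Alg_closureE :
  Alg_closure `<=` sumset (sumset X X) (prodset X (sumset X X)).
Proof.
have [C FC FE] := Alg_closure_finitely_covered.
(* The multiplier [1] puts [v - w] itself in [X + X], as required of the second factor of the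
   product term. *)
have [|[v w] [/= Xv Xw vw0] L] := @common_difference (1 :: C).
  by move=> c /[1!inE]/orP[/eqP->|/FC//]; exact: Alg_closure1.
move=> y Fy; have [|c cC Xc] := FE (y / (v - w)).
  by apply/(Alg_closure_div Fy)/Alg_closureB; exact: sub_Alg_closure.
exists (c * (v - w)); first by apply: L; rewrite inE cC orbT.
exists ((y / (v - w) - c) * (v - w)); last by rewrite mulrBl divfK // addrC subrK.
exists (y / (v - w) - c) => //; exists (v - w) => //.
by rewrite -[v - w]mul1r; apply: L; exact: mem_head.
Qed.

End Covered.

(** Padding with [0] from [X] passes from the sharper bound with two summands to the four of the
    theorem. *)
Lemma sumset_nsumset4 : sumset X X `<=` nsumset 4 X.
Proof.
move=> _ [x Xx [y Xy <-]]; apply/nsumset_seqP; exists [:: x; y; 0; 0]; split=> //.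
  by move=> z; rewrite !inE => /or4P[]/eqP->.
by rewrite !big_cons big_nil !addr0.
Qed.

End Alg.

Theorem proposition1p12 (K : fieldType) (X : set K) :
  infinite_set X ->
  approximate_subring X ->
  (forall n : nat, (0 < n)%N -> finitely_covered (Alg n X) X) ->
  is_subfield (sumset (nsumset 4 X) (prodset X (nsumset 4 X))).
Proof.
move=> Xinf [Xsym _] Xcov.
(* The set lies in the field because the field contains [X] and is closed under sums and products;
   the converse comes from [Alg_closureE]. *)
suff -> : sumset (nsumset 4 X) (prodset X (nsumset 4 X)) = Alg_closure X.
  exact: subfield_Alg_closure.
apply/seteqP; split=> [_ [a Fa [_ [x Xx [b Fb <-]] <-]]|y].
  apply: Alg_closureD => //; first exact: nsumset_Alg_closure Fa.
  apply: Alg_closureM => //; first exact: sub_Alg_closure.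
  exact: nsumset_Alg_closure Fb.
move=> /(Alg_closureE Xsym Xinf Xcov)[a Xa [_ [x Xx [b Xb <-]] <-]].
exists a; first exact: sumset_nsumset4.
by exists (x * b) => //; exists x => //; exists b => //; exact: sumset_nsumset4.
Qed.
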